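(* Let $d\ge2$, consider the $n$-qudit system $(\mathbb C^d)^{\otimes n}$, let $H$ be a Hamiltonian acting nontrivially only on a $k$-qudit subsystem, and let $|\psi\rangle$ be an $n$-qudit pure state. Then the quantum Wasserstein rate satisfies $R_{W_1}(\psi,H)\le 2\sqrt2\,k\,\|H\|_\infty$, where $\|\cdot\|_\infty$ is the operator norm.
   Context: For $\mathcal H=(\mathbb C^d)^{\otimes n}$, let $O(\mathcal H)$ be the traceless Hermitian operators on $\mathcal H$. For $A\in O(\mathcal H)$, $\|A\|_{W_1}:=\frac12\min\left\{\sum_{i=1}^n\|X_i\|_1 : A=\sum_i X_i,\ X_i\in O(\mathcal H),\ \mathrm{Tr}_i X_i=0\ \forall i\right\}$, with $\mathrm{Tr}_i$ the partial trace over the $i$-th qudit and $\|\cdot\|_1$ the trace norm. With $U_t=\exp(-iHt)$, the quantum Wasserstein rate is $R_{W_1}(\psi,H):=\lim_{\Delta t\to0}\left\|\frac{|\psi\rangle\langle\psi|-U_{\Delta t}|\psi\rangle\langle\psi|U_{\Delta t}^\dagger}{\Delta t}\right\|_{W_1}$. *)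

(* Defs.v *)
From HB Require Import structures.
From mathcomp Require Import all_boot all_order all_algebra.
From mathcomp Require Import all_classical all_reals topology normedtype sequences.
From mathcomp Require Import complex.

Set Implicit Arguments.
Unset Strict Implicit.
Unset Printing Implicit Defensive.

Import Order.TTheory GRing.Theory Num.Theory.
Import numFieldTopology.Exports numFieldNormedType.Exports.
Local Open Scope ring_scope.
Local Open Scope complex_scope.

Section QuantumDefs.
Variable R : realType.
Local Notation C := R[i].

(* Computational basis labels of (C^d)^{\otimes n}: functions from qudit positions to levels. *)
Definition qidx (n d : nat) := {ffun 'I_n -> 'I_d}.
Definition qdim (n d : nat) : nat := #|{: qidx n d}|.
(* operators on (C^d)^{\otimes n} are qdim n d x qdim n d complex matrices,
   rows/columns labelled by basis labels via enum_rank / enum_val *)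
Definition qentry n d (A : 'M[C]_(qdim n d)) (x y : qidx n d) : C :=
  A (enum_rank x) (enum_rank y).

Definition dag m p (A : 'M[C]_(m, p)) : 'M[C]_(p, m) := map_mx Num.conj A^T.

Definition is_herm m (A : 'M[C]_m) : Prop := dag A = A.

Definition psd m (A : 'M[C]_m) : Prop :=
  is_herm A /\ forall v : 'cV[C]_m, 0 <= (dag v *m A *m v) 0 0.

(* the (unique) positive semidefinite square root of a PSD matrix *)
Definition msqrt m (P : 'M[C]_m) : 'M[C]_m :=
  xget 0 [set S | psd S /\ S *m S = P].

Definition tnorm m (X : 'M[C]_m) : R := complex.Re (\tr (msqrt (dag X *m X))).

Definition vnorm m (v : 'cV[C]_m) : R := Num.sqrt (\sum_i Normc.normc (v i 0) ^+ 2).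

Definition opnorm m (A : 'M[C]_m) : R :=
  sup [set vnorm (A *m v) | v in [set v : 'cV[C]_m | vnorm v = 1]].

Definition tlherm m (A : 'M[C]_m) : Prop := is_herm A /\ \tr A = 0.

Definition qins n d (i : 'I_n) (a : 'I_d) (x : qidx n.-1 d) : qidx n d :=
  [ffun j => if unlift i j is Some j' then x j' else a].

Definition ptrace n d (i : 'I_n) (X : 'M[C]_(qdim n d)) : 'M[C]_(qdim n.-1 d) :=
  \matrix_(p, q) \sum_(a : 'I_d)
     qentry X (qins i a (enum_val p)) (qins i a (enum_val q)).

(* quantum Wasserstein norm ||A||_{W_1} (infimum = minimum of the paper) *)
Definition W1norm n d (A : 'M[C]_(qdim n d)) : R :=
  inf [set r : R | exists X : 'I_n -> 'M[C]_(qdim n d),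
        (forall i, tlherm (X i)) /\ (forall i, ptrace i (X i) = 0) /\
        A = \sum_(i < n) X i /\ r = 2^-1 * \sum_(i < n) tnorm (X i)].

Definition expsum m (A : 'M[C]_m) (N : nat) : 'M[C]_m :=
  \sum_(k < N) ((k`!)%:R^-1 *: A ^+ k).
Definition expm m (A : 'M[C]_m) : 'M[C]_m :=
  \matrix_(p, q) Complex (limn (fun N => complex.Re (expsum A N p q)))
                         (limn (fun N => complex.Im (expsum A N p q))).

Definition Ut m (H : 'M[C]_m) (t : R) : 'M[C]_m := expm ((Complex 0 (- t)) *: H).

Definition qrestr n d (S : {set 'I_n}) (x : qidx n d) : qidx #|S| d :=
  [ffun j => x (enum_val j)].

(* h \otimes I: an operator h on the qudits of S, tensored with the identity
   on the complement of S *)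
Definition embed n d (S : {set 'I_n}) (h : 'M[C]_(qdim #|S| d)) : 'M[C]_(qdim n d) :=
  \matrix_(p, q)
    (qentry h (qrestr S (enum_val p)) (qrestr S (enum_val q)) *
     (if [forall j in ~: S, enum_val p j == enum_val q j] then 1 else 0)).

(* the quantity whose limit Delta t -> 0 is R_{W_1}(psi, H) *)
Definition W1quot n d (psi : 'cV[C]_(qdim n d)) (H : 'M[C]_(qdim n d)) (t : R) : R :=
  let rho := psi *m dag psi in
  W1norm ((t%:C)^-1 *: (rho - Ut H t *m rho *m dag (Ut H t))).

End QuantumDefs.

(* Main.v *)
Require Import Defs.
From HB Require Import structures.
From mathcomp Require Import all_boot all_order all_algebra.
From mathcomp Require Import all_classical all_reals topology normedtype sequences.
From mathcomp Require Import derive trigo complex spectral ring lra.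

Set Implicit Arguments.
Unset Strict Implicit.
Unset Printing Implicit Defensive.

Import Order.TTheory GRing.Theory Num.Theory.
Import numFieldTopology.Exports numFieldNormedType.Exports.
Local Open Scope classical_set_scope.
Local Open Scope ring_scope.
Local Open Scope complex_scope.

(** The rate is the W1 norm of the derivative [A = i (H rho - rho H)], because
    the W1 norm is Lipschitz on traceless Hermitian matrices. With
    [phi = H psi], [A] is a difference [P - Q] of two rank-one positive
    matrices of total trace [2 |phi| <= 2 ||H||]. Let [H] act on the set [S]
    of [k] qudits. For a set [T] of qudits, let [reset T] be the channel that
    traces out [T] and puts a fixed basis state there. Resetting the qudits of
    [S] one after another telescopes [A] into [k] terms, each killed by the
    partial trace over one qudit and each of trace norm at most
    [2 (tr P + tr Q)]; the remainder [reset S A] vanishes since the partial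
    trace over [S] of [H rho - rho H] is zero. Hence the rate is at most
    [k (tr P + tr Q) <= 2 k ||H||]. *)

(** * Positive matrices and the trace norm *)

Section Dagger.
Context {R : realType}.
Local Notation C := R[i].

Lemma dagE m p (A : 'M[C]_(m, p)) i j : dag A i j = Num.conj (A j i).
Proof. by rewrite !mxE. Qed.

Lemma dagK m p (A : 'M[C]_(m, p)) : dag (dag A) = A.
Proof. by apply/matrixP => i j; rewrite !dagE conjCK. Qed.

Lemma dagM m p q (A : 'M[C]_(m, p)) (B : 'M[C]_(p, q)) :
  dag (A *m B) = dag B *m dag A.
Proof. by rewrite /dag trmx_mul map_mxM. Qed.

Lemma dagD m p (A B : 'M[C]_(m, p)) : dag (A + B) = dag A + dag B.
Proof. by rewrite /dag linearD /= map_mxD. Qed.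

Lemma dagN m p (A : 'M[C]_(m, p)) : dag (- A) = - dag A.
Proof. by rewrite /dag linearN /= map_mxN. Qed.

Lemma dagB m p (A B : 'M[C]_(m, p)) : dag (A - B) = dag A - dag B.
Proof. by rewrite dagD dagN. Qed.

Lemma dagZ m p (a : C) (A : 'M[C]_(m, p)) : dag (a *: A) = Num.conj a *: dag A.
Proof. by rewrite /dag linearZ /= map_mxZ. Qed.

Lemma dag0 m p : dag (0 : 'M[C]_(m, p)) = 0.
Proof. by rewrite /dag linear0 map_mx0. Qed.

Lemma dag1 m : dag (1%:M : 'M[C]_m) = 1%:M.
Proof. by rewrite /dag trmx1 map_mx1. Qed.

Lemma dag_sum m p (I : finType) (P : pred I) (F : I -> 'M[C]_(m, p)) :
  dag (\sum_(i | P i) F i) = \sum_(i | P i) dag (F i).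
Proof. by apply: (big_morph (@dag R m p)) => [A B|]; rewrite ?dagD ?dag0. Qed.

Lemma conj_realc (a : R) : Num.conj a%:C = a%:C.
Proof. by apply/CrealP; rewrite complex_real. Qed.

Lemma dag_diag m (l : 'I_m -> R) :
  dag (diag_mx (\row_j (l j)%:C)) = diag_mx (\row_j (l j)%:C).
Proof.
apply/matrixP => i j; rewrite dagE !mxE eq_sym rmorphMn /= conj_realc.
by case: eqVneq => [->|]//=; rewrite !mulr0n.
Qed.

Lemma herm_congr m p (K : 'M[C]_(p, m)) (A : 'M[C]_m) :
  is_herm A -> is_herm (K *m A *m dag K).
Proof. by rewrite /is_herm => hA; rewrite !dagM dagK hA mulmxA. Qed.

Lemma psd_congr m p (K : 'M[C]_(p, m)) (A : 'M[C]_m) :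
  psd A -> psd (K *m A *m dag K).
Proof.
move=> [hA pA]; split; first exact: herm_congr.
by move=> v; have := pA (dag K *m v); rewrite dagM dagK !mulmxA.
Qed.

Lemma psd0 m : psd (0 : 'M[C]_m).
Proof. by split; [exact: dag0 | move=> v; rewrite mulmx0 mul0mx mxE]. Qed.

Lemma psdD m (A B : 'M[C]_m) : psd A -> psd B -> psd (A + B).
Proof.
move=> [hA pA] [hB pB]; split; first by rewrite /is_herm dagD hA hB.
by move=> v; rewrite mulmxDr mulmxDl mxE addr_ge0.
Qed.

Lemma psd_sum m (I : finType) (P : pred I) (F : I -> 'M[C]_m) :
  (forall i, psd (F i)) -> psd (\sum_(i | P i) F i).
Proof.
move=> h; apply: (big_ind (@psd R m)) => //; [exact: psd0 | exact: psdD].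
Qed.

Lemma psd_diag m (l : 'I_m -> R) :
  (forall j, 0 <= l j) -> psd (diag_mx (\row_j (l j)%:C)).
Proof.
move=> l0; split; first exact: dag_diag.
move=> v; rewrite !mxE sumr_ge0// => j _.
rewrite mul_mx_diag !mxE mulrAC mulr_ge0 ?ler0c//.
by rewrite mulrC mul_conjC_ge0.
Qed.

(** The matrix is the congruence by [v] of the 1 by 1 identity. *)
Lemma psd_rank1 m (v : 'cV[C]_m) : psd (v *m dag v).
Proof.
have /psd_congr := @psd_diag 1 (fun=> 1) (fun=> ler01).
move=> /(_ _ v); rewrite (_ : diag_mx _ = 1%:M) ?mulmx1//.
by apply/matrixP => i j; rewrite !mxE.
Qed.

Lemma psd_diag_ge0 m (A : 'M[C]_m) j : psd A -> 0 <= A j j.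
Proof.
move=> [_ /(_ (delta_mx j 0))]; rewrite -mulmxA -colE.
rewrite mxE (bigD1 j)//= big1 => [|i ij].
  by rewrite !mxE !eqxx/= conjC1 mul1r addr0.
by rewrite !mxE (negPf ij)/= conjC0 mul0r.
Qed.

Lemma psd_tr_ge0 m (A : 'M[C]_m) : psd A -> 0 <= \tr A.
Proof. by move=> pA; apply: sumr_ge0 => i _; exact: psd_diag_ge0. Qed.

(** The spectral theorem with eigenvalues taken in [R], so that they can be compared and given
    absolute values. The eigenbasis is formed by the columns of [dag V]. *)
Lemma herm_spectral m (A : 'M[C]_m) : is_herm A ->
  exists (V : 'M[C]_m) (l : 'I_m -> R),
    [/\ V *m dag V = 1%:M, dag V *m V = 1%:M &
        A = dag V *m diag_mx (\row_j (l j)%:C) *m V].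
Proof.
move=> hA.
have hs : A \is hermsymmx.
  apply/is_hermitianmxP; rewrite expr0 scale1r.
  by rewrite -[LHS]hA.
have /orthomx_spectralP e := hermitian_normalmx hs.
have U := spectral_unitarymx A.
have U1 : spectralmx A *m dag (spectralmx A) = 1%:M by apply/unitarymxP.
exists (spectralmx A), (fun j => complex.Re (spectral_diag A 0 j)); split => //.
  exact: mulmx1C.
rewrite {1}e (invmx_unitary U); congr (_ *m diag_mx _ *m _).
apply/rowP => j; rewrite !mxE RRe_real//.
by have /mxOverP/(_ 0 j) := hermitian_spectral_diag_real hs.
Qed.

(* With [D = S - T], [D S + T D = 0]; on the diagonal of an eigenbasis of [D]
   this reads [d (s + t) = 0] with [d = s - t] and [s, t >= 0]. *)
Lemma psd_sqrt_unique m (S T : 'M[C]_m) :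
  psd S -> psd T -> S *m S = T *m T -> S = T.
Proof.
move=> pS pT ST.
have hD : is_herm (S - T) by rewrite /is_herm dagB pS.1 pT.1.
have [V [l [V1 V2 e]]] := herm_spectral hD.
have e' : diag_mx (\row_j (l j)%:C) = V *m S *m dag V - V *m T *m dag V.
  by rewrite -mulmxBl -mulmxBr e !mulmxA V1 mul1mx -mulmxA V1 mulmx1.
have l0 j : l j = 0.
  have z : (S - T) *m S + T *m (S - T) = 0.
    by rewrite mulmxBl mulmxBr ST addrA subrK subrr.
  have {z} : diag_mx (\row_j (l j)%:C) *m (V *m S *m dag V)
        + (V *m T *m dag V) *m diag_mx (\row_j (l j)%:C) = 0.
    have -> : diag_mx (\row_j (l j)%:C) = V *m (S - T) *m dag V.
      by rewrite e' mulmxBr mulmxBl.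
    set D := S - T in z *.
    transitivity (V *m (D *m S + T *m D) *m dag V); last first.
      by rewrite z mulmx0 mul0mx.
    rewrite [in RHS]mulmxDr mulmxDl !mulmxA.
    by rewrite -2!(mulmxA _ (dag V) V) !V2 !mulmx1.
  move: e' (psd_diag_ge0 j (psd_congr V pS)) (psd_diag_ge0 j (psd_congr V pT)).
  move: (V *m S *m dag V) (V *m T *m dag V) => S' T' e' pS' pT'.
  move=> /matrixP/(_ j j); rewrite mul_diag_mx mul_mx_diag !mxE.
  rewrite mulrC -mulrDl => /eqP; rewrite mulf_eq0.
  case/orP => [|/eqP[]//]; rewrite paddr_eq0// => /andP[/eqP s0 /eqP t0].
  have /matrixP/(_ j j) := e'; rewrite !mxE eqxx mulr1n s0 t0.
  by rewrite subr0 => -[].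
have : S - T = 0.
  rewrite e (_ : diag_mx _ = 0) ?mulmx0 ?mul0mx//.
  by apply/matrixP => i j; rewrite !mxE l0 mul0rn.
by move/eqP; rewrite subr_eq0 => /eqP.
Qed.

(** Replacing each eigenvalue by its absolute value gives a positive square root of [dag X *m X]. By
    uniqueness it is the one that [msqrt] selects. *)
Lemma tnorm_spectral m (X V : 'M[C]_m) (l : 'I_m -> R) :
  V *m dag V = 1%:M -> X = dag V *m diag_mx (\row_j (l j)%:C) *m V ->
  tnorm X = \sum_j `|l j|.
Proof.
move=> V1 eX; have V2 := mulmx1C V1.
pose S := dag V *m diag_mx (\row_j `|l j|%:C) *m V.
have pS : psd S.
  have := @psd_congr m m (dag V) _ (psd_diag (fun j => normr_ge0 (l j))).
  by rewrite dagK.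
have SS : S *m S = dag X *m X.
  rewrite eX !dagM dagK dag_diag /S !mulmxA -!(mulmxA _ V (dag V)) V1 !mulmx1.
  rewrite -!(mulmxA (dag V)) !mulmx_diag; congr (_ *m (diag_mx _ *m _)).
  apply/rowP => j; rewrite !mxE -!rmorphM /=; congr (_%:C).
  by rewrite -expr2 -normrX -expr2 ger0_norm ?sqr_ge0.
(* The default value of [xget] is excluded because [S] is a candidate. *)
rewrite /tnorm /msqrt; case: xgetP => [T _ [pT TT]|/(_ S)]; last by case.
rewrite (psd_sqrt_unique pT pS) ?TT//.
rewrite /S mxtrace_mulC mulmxA V1 mul1mx mxtrace_diag.
under eq_bigr do rewrite mxE.
by rewrite -rmorph_sum.
Qed.

(** In an eigenbasis of [P - Q] each eigenvalue is a difference of diagonal entries of the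
    conjugated [P] and [Q]. Both entries are nonnegative, so its absolute value is at most their
    sum. All later trace norm bounds that use positivity rest on this. *)
Lemma tnorm_le_psd m (P Q : 'M[C]_m) : psd P -> psd Q ->
  tnorm (P - Q) <= complex.Re (\tr P) + complex.Re (\tr Q).
Proof.
move=> pP pQ.
have hD : is_herm (P - Q) by rewrite /is_herm dagB pP.1 pQ.1.
have [V [l [V1 V2 e]]] := herm_spectral hD.
rewrite (tnorm_spectral V1 e).
have trV (A : 'M[C]_m) : \tr A = \tr (V *m A *m dag V).
  by rewrite mxtrace_mulC mulmxA V2 mul1mx.
have e' : diag_mx (\row_j (l j)%:C) = V *m P *m dag V - V *m Q *m dag V.
  by rewrite -mulmxBl -mulmxBr e !mulmxA V1 mul1mx -mulmxA V1 mulmx1.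
rewrite (trV P) (trV Q).
move: e' (psd_congr V pP) (psd_congr V pQ).
move: (V *m P *m dag V) (V *m Q *m dag V) => P' Q' e' pP' pQ'.
rewrite -raddfD /= -lecR RRe_real; last first.
  by rewrite ger0_real// addr_ge0// psd_tr_ge0.
rewrite -big_split rmorph_sum /=; apply: ler_sum => j _.
have /matrixP/(_ j j) := e'; rewrite !mxE eqxx mulr1n => ej.
have -> : `|l j|%:C = `|(l j)%:C| by rewrite normc_def/= expr0n addr0 sqrtr_sqr.
by rewrite ej (le_trans (ler_normB _ _))// !ger0_norm//; exact: psd_diag_ge0.
Qed.

(** The Jordan decomposition: [P] and [Q] carry the positive and negative parts of the
    eigenvalues. *)
Lemma tnorm_attained m (X : 'M[C]_m) : is_herm X ->
  exists P Q : 'M[C]_m, [/\ psd P, psd Q, X = P - Q &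
    tnorm X = complex.Re (\tr P) + complex.Re (\tr Q)].
Proof.
move=> /herm_spectral[V [l [V1 V2 e]]].
pose W (f : R -> R) := dag V *m diag_mx (\row_j (f (l j))%:C) *m V.
have pW f : (forall x, 0 <= f x) -> psd (W f).
  move=> f0; have := @psd_congr m m (dag V) _ (psd_diag (fun j => f0 (l j))).
  by rewrite dagK.
have tW f : complex.Re (\tr (W f)) = \sum_j f (l j).
  rewrite /W mxtrace_mulC mulmxA V1 mul1mx mxtrace_diag.
  under eq_bigr do rewrite mxE.
  by rewrite -rmorph_sum.
exists (W (fun x => (`|x| + x) / 2)), (W (fun x => (`|x| - x) / 2)); split.
- by apply: pW => x; rewrite divr_ge0//; have := ler_norm (- x); rewrite normrN; lra.
- by apply: pW => x; rewrite divr_ge0// subr_ge0 ler_norm.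
- rewrite e /W -mulmxBl -mulmxBr; congr (_ *m _ *m _).
  apply/matrixP => i j; rewrite !mxE -mulrnBl -rmorphB /=.
  by congr (_%:C *+ _); field.
- rewrite !tW (tnorm_spectral V1 e) -big_split; apply: eq_bigr => j _ /=.
  by field.
Qed.

Lemma tnorm_ge0 m (X : 'M[C]_m) : is_herm X -> 0 <= tnorm X.
Proof.
move=> /herm_spectral[V [l [V1 V2 e]]]; rewrite (tnorm_spectral V1 e).
by apply: sumr_ge0 => j _.
Qed.

(** Adding the Jordan decompositions of [X] and [Y] writes [X + Y] as a difference of positive
    matrices, to which [tnorm_le_psd] applies. *)
Lemma ler_tnormD m (X Y : 'M[C]_m) : is_herm X -> is_herm Y ->
  tnorm (X + Y) <= tnorm X + tnorm Y.
Proof.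
move=> /tnorm_attained[P [Q [pP pQ -> ->]]] /tnorm_attained[P' [Q' [pP' pQ' -> ->]]].
rewrite addrACA -opprD (le_trans (tnorm_le_psd (psdD pP pP') (psdD pQ pQ')))//.
by rewrite !mxtraceD !raddfD /= addrACA.
Qed.

End Dagger.

(** * Reset channels *)

Section Entries.
Context {R : realType} {n d : nat}.
Local Notation C := R[i].
Implicit Types (A B X : 'M[C]_(qdim n d)) (x y z : qidx n d).

Lemma sum_qdim (V : nmodType) (F : 'I_(qdim n d) -> V) :
  \sum_p F p = \sum_(x : qidx n d) F (enum_rank x).
Proof.
by rewrite (reindex (@enum_rank (qidx n d)))//; apply: onW_bij; exact: enum_rank_bij.
Qed.

Lemma qentryP A B : (forall x y, qentry A x y = qentry B x y) -> A = B.
Proof.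
by move=> h; apply/matrixP => p q; have := h (enum_val p) (enum_val q);
  rewrite /qentry !enum_valK.
Qed.

Lemma qentry_matrix (F : qidx n d -> qidx n d -> C) x y :
  qentry (\matrix_(p, q) F (enum_val p) (enum_val q)) x y = F x y.
Proof. by rewrite /qentry mxE !enum_rankK. Qed.

Lemma qentryM A B x y :
  qentry (A *m B) x y = \sum_z qentry A x z * qentry B z y.
Proof. by rewrite /qentry mxE sum_qdim. Qed.

Lemma qentry_dag A x y : qentry (dag A) x y = Num.conj (qentry A y x).
Proof. by rewrite /qentry dagE. Qed.

Lemma qentry_sum (I : finType) (P : pred I) (F : I -> 'M[C]_(qdim n d)) x y :
  qentry (\sum_(i | P i) F i) x y = \sum_(i | P i) qentry (F i) x y.
Proof. by rewrite /qentry summxE. Qed.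

Lemma mxtrace_qentry A : \tr A = \sum_x qentry A x x.
Proof. by rewrite /mxtrace sum_qdim. Qed.

Lemma qins_at (i : 'I_n) a (x : qidx n.-1 d) : qins i a x i = a.
Proof. by rewrite ffunE unlift_none. Qed.

Lemma qins_off (i j : 'I_n) a b (x : qidx n.-1 d) :
  j != i -> qins i a x j = qins i b x j.
Proof.
rewrite eq_sym => ij; rewrite !ffunE.
by have [k _ ->] := unlift_some ij.
Qed.

Lemma ptraceE (i : 'I_n) X p q : ptrace i X p q = 
  \sum_a qentry X (qins i a (enum_val p)) (qins i a (enum_val q)).
Proof. by rewrite mxE. Qed.

Lemma ptraceD (i : 'I_n) A B : ptrace i (A + B) = ptrace i A + ptrace i B.
Proof.
apply/matrixP => p q; rewrite [RHS]mxE !ptraceE -big_split.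
by apply: eq_bigr => a _; rewrite /qentry !mxE.
Qed.

Lemma ptraceB (i : 'I_n) A B : ptrace i (A - B) = ptrace i A - ptrace i B.
Proof.
apply/matrixP => p q; rewrite [RHS]mxE [X in _ = _ + X]mxE !ptraceE -sumrB.
by apply: eq_bigr => a _; rewrite /qentry !mxE.
Qed.

End Entries.

(** Inserting a level at position [i] is a bijection from pairs (label of the other qudits, level)
    to labels of all qudits. *)
Lemma mxtrace_ptrace (R : realType) n d (i : 'I_n) (X : 'M[R[i]]_(qdim n d)) :
  \tr (ptrace i X) = \tr X.
Proof.
rewrite !mxtrace_qentry.
under eq_bigr do rewrite /qentry ptraceE !enum_rankK.
rewrite pair_big /=.
pose f (xa : qidx n.-1 d * 'I_d) : qidx n d := qins i xa.2 xa.1.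
pose g (y : qidx n d) : qidx n.-1 d * 'I_d := ([ffun j => y (lift i j)], y i).
rewrite [RHS](reindex f)//.
exists g => [[x a] _|y _].
  congr (_, _); last by rewrite qins_at.
  by apply/ffunP => j; rewrite !ffunE liftK.
apply/ffunP => j; rewrite ffunE; case: unliftP => [k ->|->]//=.
by rewrite ffunE.
Qed.

(** * Kraus operators, partial resets and the telescoping decomposition *)

Section Reset.
Context {R : realType} {n d : nat} (o : 'I_d).
Local Notation C := R[i].
Implicit Types (A B X : 'M[C]_(qdim n d)) (x y z : qidx n d) (T S : {set 'I_n}).

(** Besides testing for the reset state, [blank (~: T)] selects one representative label for each
    configuration of [T], so sums over configurations of [T] need no separate index type. *)
Definition blank T x := [forall j in T, x j == o].

Definition splice T z x : qidx n d := [ffun j => if j \in T then z j else x j].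

(* [|o...o><z|] on the qudits of [T], tensored with the identity elsewhere *)
Definition kraus T z : 'M[C]_(qdim n d) :=
  \matrix_(p, q) (blank T (enum_val p) && (splice T z (enum_val p) == enum_val q))%:R.

(* [X] becomes [|o...o><o...o|_T] tensored with the partial trace of [X] over [T]. *)
Definition reset T X : 'M[C]_(qdim n d) :=
  \sum_(z | blank (~: T) z) kraus T z *m X *m dag (kraus T z).

Lemma qentry_kraus T z x y :
  qentry (kraus T z) x y = (blank T x && (splice T z x == y))%:R.
Proof. exact: (qentry_matrix (fun x y => (blank T x && (splice T z x == y))%:R)). Qed.

Lemma qentry_krausM T z X x y :
  qentry (kraus T z *m X) x y = (blank T x)%:R * qentry X (splice T z x) y.
Proof.
rewrite qentryM (bigD1 (splice T z x))//= qentry_kraus eqxx andbT big1 ?addr0//.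
by move=> w /negPf; rewrite qentry_kraus eq_sym => ->; rewrite andbF mul0r.
Qed.

Lemma qentry_kraus_congr T z w X x y :
  qentry (kraus T z *m X *m dag (kraus T w)) x y =
  (blank T x && blank T y)%:R * qentry X (splice T z x) (splice T w y).
Proof.
rewrite qentryM (bigD1 (splice T w y))//= qentry_dag qentry_kraus eqxx andbT.
rewrite big1 ?addr0 => [|v /negPf]; last first.
  by rewrite qentry_dag qentry_kraus eq_sym => ->; rewrite andbF conjC0 mulr0.
by rewrite conjC_nat qentry_krausM mulrAC -natrM mulnb.
Qed.

Lemma qentry_reset T X x y : qentry (reset T X) x y =
  (blank T x && blank T y)%:R *
  \sum_(z | blank (~: T) z) qentry X (splice T z x) (splice T z y).
Proof.
rewrite qentry_sum mulr_sumr; apply: eq_bigr => z _.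
exact: qentry_kraus_congr.
Qed.

Lemma resetB T A B : reset T (A - B) = reset T A - reset T B.
Proof. by rewrite -sumrB; apply: eq_bigr => z _; rewrite mulmxBr mulmxBl. Qed.

Lemma reset_herm T A : is_herm A -> is_herm (reset T A).
Proof.
move=> hA; rewrite /is_herm dag_sum; apply: eq_bigr => z _.
exact: herm_congr.
Qed.

Lemma reset_psd T A : psd A -> psd (reset T A).
Proof. by move=> pA; apply: psd_sum => z; exact: psd_congr. Qed.

Lemma reset_set0 X : reset finset.set0 X = X.
Proof.
apply: qentryP => x y; rewrite qentry_reset.
have b0 w : blank finset.set0 w by apply/forall_inP => j; rewrite inE.
rewrite !b0 mul1r (big_pred1 [ffun=> o]) => [|z].
  by congr (qentry X _ _); apply/ffunP => j; rewrite ffunE inE.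
apply/forall_inP/eqP => [h|-> j _]; last by rewrite ffunE.
by apply/ffunP => j; rewrite ffunE; apply/eqP/h; rewrite !inE.
Qed.

(** When every qudit is reset, the spliced labels are [z] itself and the sum over [z] is the trace
    of [X]. *)
Lemma reset_setT X : \tr X = 0 -> reset finset.setT X = 0.
Proof.
rewrite mxtrace_qentry => X0; apply: qentryP => x y; rewrite qentry_reset.
rewrite (_ : \sum_(z | _) _ = 0) ?mulr0 /qentry ?mxE//.
rewrite -[RHS]X0; apply: eq_big => [z|z _].
  by apply/forall_inP => j; rewrite !inE.
by congr (qentry X _ _); apply/ffunP => j; rewrite ffunE inE.
Qed.

(** Resetting qudit [i] in addition alters only what the partial trace over [i] discards. In
    entries, the level of [z] at [i] on the left plays the role of the traced level on the right. *)
Lemma ptrace_reset T (i : 'I_n) X : i \notin T ->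
  ptrace i (reset (i |: T) X) = ptrace i (reset T X).
Proof.
move=> iT; apply/matrixP => p q; rewrite !ptraceE.
move: (enum_val p) (enum_val q) => x y.
have TN j : j \in T -> j != i by apply: contraTN => /eqP ->.
have bT a (w : qidx n.-1 d) : blank T (qins i a w) = blank T (qins i o w).
  by apply: eq_forallb_in => j /TN ji; rewrite (qins_off a o).
(* After the reset of [i], only level [o] at [i] contributes to the left side. *)
rewrite (bigD1 o)//= [X in _ + X]big1 ?addr0 => [|a ao]; last first.
  rewrite qentry_reset (_ : blank _ (qins i a x) = false) ?mul0r//.
  apply/negbTE/forall_inPn; exists i; first by rewrite !inE eqxx.
  by rewrite qins_at.
under [RHS]eq_bigr do rewrite qentry_reset !(bT _ x, bT _ y).
rewrite -mulr_sumr qentry_reset.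
have bU w : blank (i |: T) (qins i o w) = blank T (qins i o w).
  apply/forall_inP/forall_inP => h j jT.
    by apply: h; rewrite !inE jT orbT.
  by move: jT; rewrite !inE => /predU1P[->|]; [rewrite qins_at | exact: h].
rewrite !bU; congr (_ * _).
(* Grouping the configurations of [i |: T] by their level at [i] matches the sum over [a] on the
   right. *)
rewrite (partition_big (fun z => z i) predT)//=.
apply: eq_bigr => a _.
(* For fixed [a], [u a] and [u o] are inverse to each other between configurations of [T] and
   configurations of [i |: T] with level [a] at [i]. *)
pose u (b : 'I_d) z : qidx n d := [ffun j => if j == i then b else z j].
rewrite (reindex_onto (u a) (u o)) => [|z /andP[_ /eqP za]]; last first.
  by apply/ffunP => j; rewrite !ffunE; case: eqVneq => [->|].
apply: eq_big => [z|z _].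
  rewrite ffunE eqxx eqxx andbT.
  apply/andP/forall_inP => [[/forall_inP h /eqP e] j|h].
    rewrite inE => jT; have [ji|ji] := eqVneq j i.
      by rewrite -e !ffunE ji eqxx.
    by have := h j; rewrite !inE negb_or ji jT ffunE (negPf ji); apply.
  split.
    apply/forall_inP => j; rewrite !inE negb_or ffunE => /andP[ji jT].
    by rewrite (negPf ji) h// inE.
  apply/eqP/ffunP => j; rewrite !ffunE.
  by case: eqVneq => [->|//]; apply/esym/eqP/h; rewrite inE.
have mE w : splice (i |: T) (u a z) (qins i o w) = splice T z (qins i a w).
  apply/ffunP => j; rewrite ffunE [RHS]ffunE !inE.
  have [->|ji]/= := eqVneq j i; first by rewrite (negPf iT) qins_at ffunE eqxx.
  by case: ifP => _; [rewrite ffunE (negPf ji) | exact: qins_off].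
by rewrite !mE.
Qed.

(** A chain from the empty set to [S] that gains at most one qudit per step. It is indexed by all
    [n] positions, so step [i] of the telescope belongs to qudit [i]; steps outside [S] change
    nothing. *)
Definition below S (m : nat) : {set 'I_n} := [set j in S | (j < m)%N]%SET.

Lemma below0 S : below S 0 = finset.set0.
Proof. by apply/setP => j; rewrite !inE andbF. Qed.

Lemma below_all S : below S n = S.
Proof. by apply/setP => j; rewrite !inE ltn_ord andbT. Qed.

Lemma belowS S (i : 'I_n) :
  below S i.+1 = if i \in S then i |: below S i else below S i.
Proof.
apply/setP => j; case: ifP => iS; rewrite !inE ltnS leq_eqVlt.
  by rewrite val_eqE; case: eqVneq => [->|]//=; rewrite iS.
by rewrite val_eqE; case: eqVneq => [->|]//=; rewrite iS.
Qed.

Lemma ptrace_reset_below S (i : 'I_n) X :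
  ptrace i (reset (below S i.+1) X) = ptrace i (reset (below S i) X).
Proof.
rewrite belowS; case: ifP => // iS; apply: ptrace_reset.
by rewrite !inE ltnn andbF.
Qed.

(** The trace factors through the partial trace over qudit [m], which does not see step [m] of the
    chain. *)
Lemma mxtrace_reset_below S m X : (m <= n)%N ->
  \tr (reset (below S m) X) = \tr X.
Proof.
elim: m => [_|m IH mn]; first by rewrite below0 reset_set0.
rewrite -[RHS](IH (ltnW mn)) -(mxtrace_ptrace (Ordinal mn)).
by rewrite (ptrace_reset_below S (Ordinal mn)) mxtrace_ptrace.
Qed.

(** The terms are the successive differences along the chain of resets. Their sum telescopes to
    [P - Q] minus its reset on [S], which vanishes. *)
Lemma W1_decomposition S (P Q : 'M[C]_(qdim n d)) :
  psd P -> psd Q -> reset S (P - Q) = 0 ->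
  exists X : 'I_n -> 'M[C]_(qdim n d),
    [/\ forall i, tlherm (X i), forall i, ptrace i (X i) = 0,
        P - Q = \sum_i X i &
        forall i, tnorm (X i) <= (i \in S)%:R * 2 *
          (complex.Re (\tr P) + complex.Re (\tr Q))].
Proof.
move=> pP pQ S0; set B := P - Q in S0 *.
have hB : is_herm B by rewrite /is_herm dagB pP.1 pQ.1.
exists (fun i => reset (below S i) B - reset (below S i.+1) B).
have pt0 i : ptrace i (reset (below S i) B - reset (below S i.+1) B) = 0.
  by rewrite ptraceB ptrace_reset_below subrr.
split=> // [i||i].
- split; last by rewrite -(mxtrace_ptrace i) pt0 mxtrace0.
  by rewrite /is_herm dagB !(reset_herm _ hB).
- rewrite -(big_mkord predT (fun i => reset (below S i) B - reset (below S i.+1) B)).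
  rewrite (eq_bigr (fun i => - (reset (below S i.+1) B - reset (below S i) B))).
    by rewrite sumrN telescope_sumr// below_all S0 below0 reset_set0 sub0r opprK.
  by move=> i _; rewrite opprB.
- case: (boolP (i \in S)) => iS; last first.
    (* Outside [S] the term is zero, written as [0 - 0] to reuse the bound for positive matrices. *)
    rewrite !mul0r belowS (negPf iS) subrr -[0]subr0.
    by rewrite (le_trans (tnorm_le_psd (psd0 _) (psd0 _)))// mxtrace0 addr0.
  set X := _ - _.
  (* The four resets are regrouped into a difference of two positive matrices; each has trace
     [\tr P + \tr Q], since resets preserve the trace. This yields the factor 2. *)
  have -> : X = (reset (below S i) P + reset (below S i.+1) Q)
      - (reset (below S i) Q + reset (below S i.+1) P).
    by rewrite /X /B !resetB opprB opprD addrACA addrAC addrA.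
  rewrite (le_trans (tnorm_le_psd (psdD _ _) (psdD _ _)))//; try exact: reset_psd.
  rewrite !mxtraceD !mxtrace_reset_below// ?(ltnW (ltn_ord i))//.
  by rewrite !raddfD /=; lra.
Qed.

(** On [S] this expands the row vector [<z| h] in the basis of the [<w|]; the identity on the other
    qudits passes through. *)
Lemma kraus_embed S (h : 'M[C]_(qdim #|S| d)) z : blank (~: S) z ->
  kraus S z *m embed h =
  \sum_(w | blank (~: S) w) qentry (embed h) z w *: kraus S w.
Proof.
move=> bz; apply: qentryP => x y; rewrite qentry_krausM qentry_sum.
have eE u v : qentry (embed h) u v = qentry h (qrestr S u) (qrestr S v) *
    (if [forall j in ~: S, u j == v j] then 1 else 0).
  exact: (qentry_matrix (fun u v => qentry h (qrestr S u) (qrestr S v) *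
    (if [forall j in ~: S, u j == v j] then 1 else 0))).
have rE (u v : qidx n d) : (forall j, j \in S -> u j = v j) -> qrestr S u = qrestr S v.
  by move=> uv; apply/ffunP => j; rewrite !ffunE uv// enum_valP.
have qZ (a : C) (M : 'M[C]_(qdim n d)) : qentry (a *: M) x y = a * qentry M x y.
  by rewrite /qentry mxE.
under eq_bigr do rewrite qZ qentry_kraus.
case: (boolP (blank S x)) => bx /=; last first.
  by rewrite mul0r big1// => w _; rewrite mulr0.
rewrite mul1r eE (rE _ z) => [|j jS]; last by rewrite ffunE jS.
have [/forall_inP xy|/forall_inPn[j jS xy]] := ifPn.
  (* The only contributing [w] agrees with [y] on [S] and is blank elsewhere. *)
  pose w0 : qidx n d := splice S y [ffun=> o].
  have bw0 : blank (~: S) w0.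
    by apply/forall_inP => j; rewrite inE !ffunE => /negPf ->.
  rewrite (bigD1 w0)//= [X in _ + X]big1 ?addr0 => [|w /andP[bw ww]]; last first.
    case: eqP => [e|]; rewrite ?mulr0//; case/eqP: ww.
    apply/ffunP => j; rewrite !ffunE -e ffunE; case: ifPn => jS; first by rewrite jS.
    by apply/eqP/(forall_inP bw); rewrite inE.
  rewrite eE ifT; last first.
    apply/forall_inP => j jS; move/forall_inP: bz => /(_ j jS)/eqP ->.
    by move/forall_inP: bw0 => /(_ j jS)/eqP ->.
  rewrite (rE w0 y) => [|j jS]; last by rewrite ffunE jS.
  rewrite (_ : splice S w0 x = y) ?eqxx ?mulr1//.
  apply/ffunP => j; rewrite ffunE; case: ifPn => jS; first by rewrite ffunE jS.
  by have := xy j; rewrite !inE jS ffunE (negPf jS) => /(_ isT)/eqP.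
(* If [x] and [y] differ outside [S], both sides vanish. *)
rewrite mulr0 big1// => w _; case: eqP => [e|]; rewrite ?mulr0//.
by move: jS xy; rewrite -e inE !ffunE => /negPf ->; rewrite eqxx.
Qed.

(** The partial trace over [S] is cyclic for operators acting on [S]. Expanding the Hamiltonian
    against the Kraus operators on either side of [X] gives the same double sum with [z] and [w]
    exchanged. *)
Lemma reset_commutator S (h : 'M[C]_(qdim #|S| d)) X :
  is_herm (embed h) -> reset S (embed h *m X - X *m embed h) = 0.
Proof.
move=> hH; rewrite resetB; apply/eqP; rewrite subr_eq0; apply/eqP.
transitivity (\sum_(z | blank (~: S) z) \sum_(w | blank (~: S) w)
    qentry (embed h) z w *: (kraus S w *m X *m dag (kraus S z))).
  apply: eq_bigr => z bz; rewrite mulmxA kraus_embed// !mulmx_suml.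
  by apply: eq_bigr => w _; rewrite -!scalemxAl.
rewrite exchange_big; apply: eq_bigr => z bz.
(* Hermiticity turns the right factor into the adjoint of a product [kraus S z *m embed h], so the
   same expansion applies. *)
rewrite -[X in _ *m (_ *m X)]hH -!mulmxA -dagM kraus_embed// dag_sum !mulmx_sumr.
apply: eq_bigr => w _.
by rewrite dagZ -qentry_dag hH -!scalemxAr !mulmxA.
Qed.

End Reset.

(** * The propagator *)

Section Exponential.
Context {R : realType}.
Local Notation C := R[i].

(** Convergence of real and imaginary parts, the form in which [expm] takes its limits. *)
Definition ccvg (u : nat -> C) (l : C) :=
  (complex.Re (u N) @[N --> \oo] --> complex.Re l) /\
  (complex.Im (u N) @[N --> \oo] --> complex.Im l).

Lemma ReM (x y : C) : complex.Re (x * y) =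
  complex.Re x * complex.Re y - complex.Im x * complex.Im y.
Proof. by case: x y => [a b] [c e]. Qed.

Lemma ImM (x y : C) : complex.Im (x * y) =
  complex.Re x * complex.Im y + complex.Im x * complex.Re y.
Proof. by case: x y => [a b] [c e]. Qed.

Lemma ccvgMl (a : C) u l : ccvg u l -> ccvg (fun N => a * u N) (a * l).
Proof.
move=> [ur ui]; split.
  under eq_fun do rewrite ReM.
  by rewrite ReM; apply: cvgB; apply: cvgM => //; exact: cvg_cst.
under eq_fun do rewrite ImM.
by rewrite ImM; apply: cvgD; apply: cvgM => //; exact: cvg_cst.
Qed.

Lemma ccvg_sum (I : finType) (u : I -> nat -> C) (l : I -> C) :
  (forall i, ccvg (u i) (l i)) -> ccvg (fun N => \sum_i u i N) (\sum_i l i).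
Proof.
move=> h; split.
  under eq_fun do rewrite raddf_sum.
  by rewrite raddf_sum; apply: cvg_big => [|i _]; [exact: add_continuous | exact: (h i).1].
under eq_fun do rewrite raddf_sum.
by rewrite raddf_sum; apply: cvg_big => [|i _]; [exact: add_continuous | exact: (h i).2].
Qed.

Lemma expm_ccvg m (A L : 'M[C]_m) :
  (forall p q, ccvg (fun N => expsum A N p q) (L p q)) -> expm A = L.
Proof.
move=> h; apply/matrixP => p q; rewrite mxE.
have [/cvg_lim -> // /cvg_lim -> //] := h p q.
by case: (L p q).
Qed.

(** This is $e^{-ix}$, with the sign convention of [Ut]. *)
Definition expi (x : R) : C := Complex (cos x) (- sin x).

(** Even powers of $-ix$ are real and give the cosine series, odd ones are imaginary and give the
    sine series. *)
Lemma exp_coeff_expi (x : R) k :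
  (k`!%:R^-1 : C) * (Complex 0 (- x)) ^+ k =
  Complex (cos_coeff x k) (- sin_coeff x k).
Proof.
have E m : (Complex 0 (- x)) ^+ m.*2 = ((-1) ^+ m * x ^+ m.*2)%:C :> C.
  elim: m => [|m IH]; first by rewrite !expr0 mulr1.
  by rewrite doubleS !exprS IH; apply/eqP; rewrite eq_complex /=; apply/andP; split;
    apply/eqP; ring.
have fE : (k`!%:R^-1 : C) = (k`!%:R^-1 : R)%:C by rewrite fmorphV rmorph_nat.
rewrite fE /cos_coeff /sin_coeff /= -exprnP; move: (k`!%:R^-1 : R) => f.
have [m [b ->]] : exists m (b : bool), k = (b + m.*2)%N.
  by exists k./2, (odd k); rewrite odd_double_half.
case: b => /=.
  rewrite add1n exprS E /= odd_double doubleK /=.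
  apply/eqP; rewrite eq_complex /=; apply/andP; split; apply/eqP; first by ring.
  by rewrite exprS; ring.
rewrite add0n E odd_double doubleK /=.
by apply/eqP; rewrite eq_complex /=; apply/andP; split; apply/eqP; ring.
Qed.

Lemma ccvg_expi (x : R) :
  ccvg (fun N => \sum_(k < N) (k`!%:R^-1 : C) * (Complex 0 (- x)) ^+ k) (expi x).
Proof.
split.
  rewrite (_ : (fun N => _) = series (cos_coeff x)); last first.
    apply/funext => N; rewrite raddf_sum /= /series /= big_mkord.
    by apply: eq_bigr => k _; rewrite exp_coeff_expi.
  by rewrite /expi/= cos.unlock; exact: is_cvg_series_cos_coeff.
rewrite (_ : (fun N => _) = - series (sin_coeff x)); last first.
  apply/funext => N; rewrite [RHS](_ : _ = - \sum_(0 <= k < N) sin_coeff x k)//.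
  rewrite big_mkord -sumrN raddf_sum /=.
  by apply: eq_bigr => k _; rewrite exp_coeff_expi.
by rewrite /expi/= sin.unlock; apply: cvgN; exact: is_cvg_series_sin_coeff.
Qed.

Lemma unitary_conjX m (V : 'M[C]_m) (c : 'I_m -> C) k : V *m dag V = 1%:M ->
  (dag V *m diag_mx (\row_j c j) *m V) ^+ k = dag V *m diag_mx (\row_j c j ^+ k) *m V.
Proof.
move=> V1; have V2 := mulmx1C V1; elim: k => [|k IH].
  rewrite expr0 (_ : diag_mx _ = 1%:M) ?mulmx1 ?V2//.
  by apply/matrixP => i j; rewrite !mxE expr0.
rewrite exprS IH -mulmxE !mulmxA -(mulmxA _ V (dag V)) V1 mulmx1.
rewrite -(mulmxA (dag V)) mulmx_diag; congr (_ *m diag_mx _ *m _).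
by apply/rowP => j; rewrite !mxE exprS.
Qed.

(** Each entry is a fixed linear combination of the diagonal values, so scalar limits carry over to
    matrix entries. *)
Lemma unitary_diagE m (V : 'M[C]_m) (c : 'I_m -> C) p q :
  (dag V *m diag_mx (\row_j c j) *m V) p q = \sum_j (dag V p j * V j q) * c j.
Proof.
by rewrite mxE; apply: eq_bigr => j _; rewrite mul_mx_diag !mxE mulrAC.
Qed.

(** The partial sums of the exponential are diagonal in the same basis, which reduces the matrix
    series to one scalar series per eigenvalue. *)
Lemma Ut_spectral m (V : 'M[C]_m) (l : 'I_m -> R) (t : R) : V *m dag V = 1%:M ->
  Ut (dag V *m diag_mx (\row_j (l j)%:C) *m V) t =
  dag V *m diag_mx (\row_j expi (t * l j)) *m V.
Proof.
move=> V1; apply: expm_ccvg => p q.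
rewrite unitary_diagE.
rewrite (_ : (fun N => _) = fun N => \sum_j (dag V p j * V j q) *
    \sum_(k < N) (k`!%:R^-1 : C) * (Complex 0 (- (t * l j))) ^+ k).
  by apply: ccvg_sum => j; apply: ccvgMl; exact: ccvg_expi.
apply/funext => N.
have -> : Complex 0 (- t) *: (dag V *m diag_mx (\row_j (l j)%:C) *m V) =
    dag V *m diag_mx (\row_j Complex 0 (- (t * l j))) *m V.
  rewrite scalemxAl scalemxAr; congr (_ *m _ *m _).
  apply/matrixP => i j; rewrite !mxE; case: (i == j); last by rewrite !mulr0n mulr0.
  by rewrite !mulr1n; apply/eqP; rewrite eq_complex /=; apply/andP; split; apply/eqP; ring.
rewrite /expsum summxE.
under eq_bigr do rewrite mxE unitary_conjX// unitary_diagE mulr_sumr.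
rewrite exchange_big; apply: eq_bigr => j _; rewrite mulr_sumr.
by apply: eq_bigr => k _; rewrite mulrCA.
Qed.

Lemma expi_unit x : Num.conj (expi x) * expi x = 1.
Proof.
rewrite mulrC -normCK normc_def -rmorphXn /= sqr_sqrtr ?addr_ge0 ?sqr_ge0//.
by rewrite sqrrN cos2Dsin2.
Qed.

Lemma Ut_unitary m (H : 'M[C]_m) t : is_herm H -> dag (Ut H t) *m Ut H t = 1%:M.
Proof.
move=> /herm_spectral[V [l [V1 V2 ->]]]; rewrite Ut_spectral//.
rewrite !dagM dagK !mulmxA -(mulmxA _ V (dag V)) V1 mulmx1.
rewrite -(mulmxA (dag V)) (_ : _ *m diag_mx _ = 1%:M) ?mulmx1//.
apply/matrixP => i j; rewrite mul_mx_diag mxE dagE !mxE.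
case: eqVneq => [->|]; last by rewrite mulr0n conjC0 mul0r.
by rewrite !mulr1n expi_unit.
Qed.

End Exponential.

(** * The W1 norm *)

Section EntrywiseNorm.
Context {R : realType}.
Local Notation C := R[i].
Local Notation normc := (@Normc.normc R).

Lemma normc_ge0 (z : C) : 0 <= normc z.
Proof. by case: z => a b; exact: sqrtr_ge0. Qed.

Lemma normc_conj (z : C) : normc (Num.conj z) = normc z.
Proof. by case: z => a b; rewrite /= sqrrN. Qed.

Lemma normc_sum (I : finType) (F : I -> C) :
  normc (\sum_i F i) <= \sum_i normc (F i).
Proof.
apply: (big_ind2 (fun x y => normc x <= y)) => //.
  by rewrite Normc.normc0.
by move=> x a y b xa yb; rewrite (le_trans (le_normcD _ _))// lerD.
Qed.

Lemma normc_real (a : R) : normc a%:C = `|a|.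
Proof. by rewrite /= expr0n addr0 sqrtr_sqr. Qed.

Lemma normc_imag (a : R) : normc (Complex 0 a) = `|a|.
Proof. by rewrite /= expr0n add0r sqrtr_sqr. Qed.

Lemma normc_le (a b : R) : normc (Complex a b) <= `|a| + `|b|.
Proof.
have -> : Complex a b = a%:C + Complex 0 b.
  by apply/eqP; rewrite eq_complex /= addr0 add0r !eqxx.
by rewrite (le_trans (le_normcD _ _))// normc_real normc_imag.
Qed.

(** A submultiplicative norm, invariant under [dag], in which all error terms are estimated. *)
Definition l1norm m p (A : 'M[C]_(m, p)) : R := \sum_i \sum_j normc (A i j).

Lemma l1norm_ge0 m p (A : 'M[C]_(m, p)) : 0 <= l1norm A.
Proof. by do 2 (apply: sumr_ge0 => ? _); exact: normc_ge0. Qed.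

Lemma l1normD m p (A B : 'M[C]_(m, p)) : l1norm (A + B) <= l1norm A + l1norm B.
Proof.
rewrite -big_split; apply: ler_sum => i _; rewrite -big_split; apply: ler_sum => j _.
by rewrite mxE le_normcD.
Qed.

Lemma l1normZ m p a (A : 'M[C]_(m, p)) : l1norm (a *: A) = normc a * l1norm A.
Proof.
rewrite mulr_sumr; apply: eq_bigr => i _; rewrite mulr_sumr; apply: eq_bigr => j _.
by rewrite mxE Normc.normcM.
Qed.

Lemma l1normN m p (A : 'M[C]_(m, p)) : l1norm (- A) = l1norm A.
Proof. by do 2 (apply: eq_bigr => ? _); rewrite mxE normcN. Qed.

Lemma l1norm_dag m p (A : 'M[C]_(m, p)) : l1norm (dag A) = l1norm A.
Proof.
rewrite /l1norm exchange_big; do 2 (apply: eq_bigr => ? _).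
by rewrite dagE normc_conj.
Qed.

Lemma l1normM m p q (A : 'M[C]_(m, p)) (B : 'M[C]_(p, q)) :
  l1norm (A *m B) <= l1norm A * l1norm B.
Proof.
rewrite mulr_suml; apply: ler_sum => i _.
apply: (@le_trans _ _ (\sum_k normc (A i k) * \sum_j normc (B k j))).
  under [leRHS]eq_bigr do rewrite mulr_sumr.
  rewrite exchange_big; apply: ler_sum => j _; rewrite mxE.
  rewrite (le_trans (normc_sum _))// ler_sum// => k _.
  by rewrite Normc.normcM.
rewrite mulr_suml; apply: ler_sum => k _; rewrite ler_wpM2l ?normc_ge0//.
rewrite [leRHS](bigD1 k)//= lerDl; do 2 (apply: sumr_ge0 => ? _).
exact: normc_ge0.
Qed.

Lemma l1norm_diag m (c : 'I_m -> C) :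
  l1norm (diag_mx (\row_j c j)) = \sum_j normc (c j).
Proof.
apply: eq_bigr => i _; rewrite (bigD1 i)//= !mxE eqxx mulr1n big1 ?addr0//.
by move=> j; rewrite eq_sym !mxE => /negPf ->; rewrite mulr0n Normc.normc0.
Qed.

Lemma mulcJ_normc (z : C) : z * Num.conj z = (normc z ^+ 2)%:C.
Proof. by rewrite -normCK -rmorphXn. Qed.

Lemma vnorm_sqr m (v : 'cV[C]_m) : vnorm v ^+ 2 = \sum_i normc (v i 0) ^+ 2.
Proof. by rewrite sqr_sqrtr// sumr_ge0// => i _; exact: sqr_ge0. Qed.

Lemma tr_rank1 m (v : 'cV[C]_m) : \tr (v *m dag v) = (vnorm v ^+ 2)%:C.
Proof.
rewrite vnorm_sqr rmorph_sum; apply: eq_bigr => i _.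
by rewrite mxE big_ord1 dagE mulcJ_normc.
Qed.

Lemma vnorm_ge0 m (v : 'cV[C]_m) : 0 <= vnorm v.
Proof. exact: sqrtr_ge0. Qed.

Lemma vnorm_eq0 m (v : 'cV[C]_m) : vnorm v = 0 -> v = 0.
Proof.
move=> v0; have /esym/eqP := vnorm_sqr v; rewrite v0 expr0n.
rewrite psumr_eq0 => [|i _]; last exact: sqr_ge0.
move=> /allP h; apply/colP => i; rewrite mxE.
have := h i (mem_index_enum _); rewrite /= sqrf_eq0 => /eqP.
exact: Normc.eq0_normc.
Qed.

Lemma sqrt_sumsq_le (I : finType) (a : I -> R) : (forall i, 0 <= a i) ->
  Num.sqrt (\sum_i a i ^+ 2) <= \sum_i a i.
Proof.
move=> a0; have s0 : 0 <= \sum_i a i by exact: sumr_ge0.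
rewrite -[leRHS]ger0_norm// -sqrtr_sqr ler_sqrt ?sqr_ge0//.
rewrite expr2 mulr_suml; apply: ler_sum => i _.
by rewrite expr2 ler_wpM2l// (bigD1 i)//= lerDl sumr_ge0.
Qed.

Lemma vnorm_le_l1norm m (v : 'cV[C]_m) : vnorm v <= l1norm v.
Proof.
apply: le_trans (sqrt_sumsq_le (fun i => normc_ge0 (v i 0))) _.
by rewrite le_eqVlt; apply/orP; left; apply/eqP/eq_bigr => i _; rewrite big_ord1.
Qed.

Lemma vnorm_le_opnorm m (A : 'M[C]_m) v : vnorm v = 1 -> vnorm (A *m v) <= opnorm A.
Proof.
move=> v1; apply: ub_le_sup; last by exists v.
(* The supremum needs some upper bound: entries of a unit vector have modulus at most 1, so its
   [l1norm] is at most [m]. *)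
exists (l1norm A * m%:R) => _ [w /= w1 <-].
rewrite (le_trans (vnorm_le_l1norm _))// (le_trans (l1normM _ _))//.
rewrite ler_wpM2l ?l1norm_ge0// /l1norm.
rewrite -[leRHS](_ : \sum_(i < m) 1 = _); last first.
  by rewrite sumr_const card_ord.
apply: ler_sum => i _; rewrite big_ord1.
rewrite -[leRHS]w1 -[leLHS]ger0_norm ?normc_ge0// -sqrtr_sqr ler_sqrt; last first.
  by rewrite sumr_ge0// => j _; exact: sqr_ge0.
by rewrite (bigD1 i)//= lerDl sumr_ge0// => j _; exact: sqr_ge0.
Qed.

(** For the root [S], the diagonals of [dag S *m S] and [dag X *m X] agree, so corresponding columns
    of [S] and [X] have equal Euclidean norm. Hence [S i i] is bounded by the norm of column [i] of
    [X]. If [msqrt] took its default 0, the bound would be trivial. *)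
Lemma tnorm_le_l1norm m (X : 'M[C]_m) : tnorm X <= l1norm X.
Proof.
rewrite /tnorm /msqrt; case: xgetP => [S _ [[hS _] SS]|_]; last first.
  by rewrite mxtrace0 /= l1norm_ge0.
rewrite raddf_sum /= /l1norm exchange_big; apply: ler_sum => i _ /=.
have colE (A : 'M[C]_m) : (dag A *m A) i i = (\sum_j normc (A j i) ^+ 2)%:C.
  rewrite mxE rmorph_sum; apply: eq_bigr => j _ /=.
  by rewrite dagE mulrC mulcJ_normc.
have /complexI e : (\sum_j normc (S j i) ^+ 2)%:C = (\sum_j normc (X j i) ^+ 2)%:C :> C.
  by rewrite -!colE hS SS.
apply: le_trans (sqrt_sumsq_le (fun j => normc_ge0 (X j i))).
rewrite -e (@le_trans _ _ (normc (S i i)))//.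
  case: (S i i) => a b /=; rewrite (le_trans (ler_norm _))// -sqrtr_sqr ler_sqrt.
    by rewrite lerDl sqr_ge0.
  by rewrite addr_ge0 ?sqr_ge0.
rewrite -[leLHS]ger0_norm ?normc_ge0// -sqrtr_sqr ler_sqrt; last first.
  by rewrite sumr_ge0// => j _; exact: sqr_ge0.
by rewrite (bigD1 i)//= lerDl sumr_ge0// => j _; exact: sqr_ge0.
Qed.

End EntrywiseNorm.

(** * Costs of decompositions, triangle inequality and Lipschitz bound *)

Section W1.
Context {R : realType} {n d : nat} (o : 'I_d).
Local Notation C := R[i].
Implicit Types A B P Q : 'M[C]_(qdim n d).

Definition W1costs A := [set r : R | exists X : 'I_n -> 'M[C]_(qdim n d),
        (forall i, tlherm (X i)) /\ (forall i, ptrace i (X i) = 0) /\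
        A = \sum_(i < n) X i /\ r = 2^-1 * \sum_(i < n) tnorm (X i)].

Lemma W1costs_lbound A : lbound (W1costs A) 0.
Proof.
move=> _ [X [hX [_ [_ ->]]]]; rewrite mulr_ge0 ?invr_ge0// sumr_ge0// => i _.
by apply: tnorm_ge0; case: (hX i).
Qed.

(** Only qudits of [S] contribute, and the factor 2 per qudit cancels the factor one half of the
    cost. *)
Lemma W1costs_psd (S : {set 'I_n}) P Q : psd P -> psd Q -> reset o S (P - Q) = 0 ->
  exists2 r, W1costs (P - Q) r &
    r <= #|S|%:R * (complex.Re (\tr P) + complex.Re (\tr Q)).
Proof.
move=> pP pQ S0; have [X [h1 h2 h3 h4]] := W1_decomposition pP pQ S0.
exists (2^-1 * \sum_i tnorm (X i)); first by exists X.
rewrite mulrC ler_pdivrMr//.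
apply: (le_trans (ler_sum _ (fun i _ => h4 i))).
have cS : \sum_i (i \in S)%:R = #|S|%:R :> R.
  by rewrite -natr_sum -sum1_card [in RHS]big_mkcond.
by rewrite -!mulr_suml cS mulrAC.
Qed.

Lemma W1norm_le (S : {set 'I_n}) P Q : psd P -> psd Q -> reset o S (P - Q) = 0 ->
  W1norm (P - Q) <= #|S|%:R * (complex.Re (\tr P) + complex.Re (\tr Q)).
Proof.
move=> pP pQ S0; have [r Wr] := W1costs_psd pP pQ S0.
by apply: le_trans; apply: ge_inf => //; exists 0; exact: W1costs_lbound.
Qed.

(** The decomposition is applied with all qudits in [S], where tracelessness makes the full reset
    vanish, and to the Jordan decomposition of [B]. *)
Lemma W1norm_le_l1norm B : tlherm B -> W1norm B <= n%:R * l1norm B.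
Proof.
move=> [hB tB]; apply: (@le_trans _ _ (n%:R * tnorm B)); last first.
  by rewrite ler_wpM2l ?tnorm_le_l1norm.
have [P [Q [pP pQ e ->]]] := tnorm_attained hB.
have := @W1norm_le finset.setT P Q pP pQ; rewrite -e => /(_ (reset_setT o tB)).
by rewrite cardsT card_ord.
Qed.

(** Lower bounds pass to an infimum only for a nonempty set. *)
Lemma W1costs_nonempty B : tlherm B -> W1costs B !=set0.
Proof.
move=> [hB tB]; have [P [Q [pP pQ e _]]] := tnorm_attained hB.
have := @W1costs_psd finset.setT P Q pP pQ; rewrite -e => /(_ (reset_setT o tB)).
by case=> r ? _; exists r.
Qed.

Lemma W1normD A B : tlherm A -> tlherm B -> W1norm (A + B) <= W1norm A + W1norm B.
Proof.
(* The two infima are removed in turn, by moving the other norm across the inequality;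
   decompositions of [A] and [B] are then added termwise. *)
move=> tA tB; rewrite -lerBlDr; apply: lb_le_inf; first exact: W1costs_nonempty.
move=> _ [X [X1 [X2 [eX ->]]]]; rewrite lerBlDr -lerBlDl.
apply: lb_le_inf; first exact: W1costs_nonempty.
move=> _ [Y [Y1 [Y2 [eY ->]]]]; rewrite lerBlDl.
apply: (@le_trans _ _ (2^-1 * \sum_(i < n) tnorm (X i + Y i))).
  apply: ge_inf; first by exists 0; exact: W1costs_lbound.
  exists (fun i => X i + Y i); split=> [i|].
    have [x1 x2] := X1 i; have [y1 y2] := Y1 i.
    by split; [rewrite /is_herm dagD x1 y1 | rewrite mxtraceD x2 y2 addr0].
  split=> [i|]; last by rewrite big_split /= eX eY.
  by rewrite ptraceD X2 Y2 addr0.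
rewrite -mulrDr ler_wpM2l ?invr_ge0// -big_split; apply: ler_sum => i _.
by apply: ler_tnormD; [case: (X1 i) | case: (Y1 i)].
Qed.

Lemma tlhermB A B : tlherm A -> tlherm B -> tlherm (A - B).
Proof.
move=> [hA tA] [hB tB]; split; first by rewrite /is_herm dagB hA hB.
by rewrite linearB /= tA tB subrr.
Qed.

Lemma W1norm_lipschitz A B : tlherm A -> tlherm B ->
  `|W1norm A - W1norm B| <= n%:R * l1norm (A - B).
Proof.
move=> tA tB; rewrite ler_norml; apply/andP; split.
  rewrite lerNl opprB lerBlDl -[B in W1norm B](subrK A).
  rewrite (le_trans (W1normD (tlhermB tB tA) tA))// addrC lerD2l.
  by rewrite -(l1normN (A - B)) opprB W1norm_le_l1norm//; exact: tlhermB.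
rewrite lerBlDl -[A in W1norm A](subrK B).
rewrite (le_trans (W1normD (tlhermB tA tB) tB))// addrC lerD2l.
by rewrite W1norm_le_l1norm//; exact: tlhermB.
Qed.

End W1.

(** * The rate *)

Section Rate.
Context {R : realType}.
Local Notation C := R[i].

Lemma is_derive_quotient (f : R -> R) (l : R) : is_derive (0 : R) 1 f l ->
  (f t - f 0) / t @[t --> 0^'] --> l.
Proof.
move=> [/= df <-]; rewrite /derive; move: df; rewrite /derivable.
rewrite (_ : (fun h => _) = fun t => (f t - f 0) / t)//.
by apply/funext => h /=; rewrite addr0 [h *: 1]mulr1 [LHS]mulrC.
Qed.

(** In an eigenbasis the remainder is diagonal, and its size divided by [t] is controlled by the
    errors of the difference quotients of cosine and sine at 0. *)
Lemma Ut_first_order m (H : 'M[C]_m) : is_herm H ->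
  exists2 e : R -> R, e t @[t --> 0^'] --> 0 &
    forall t, t != 0 -> l1norm (Ut H t - 1%:M + Complex 0 t *: H) <= `|t| * e t.
Proof.
move=> /herm_spectral[V [l [V1 V2 ->]]].
pose f j t := `|(cos (t * l j) - cos (0 * l j)) / t - 0|.
pose g j t := `|(sin (t * l j) - sin (0 * l j)) / t - l j|.
exists (fun t => l1norm (dag V) * (\sum_j (f j t + g j t)) * l1norm V).
  rewrite -[X in _ --> X](mul0r (l1norm V)); apply: cvgM; last exact: cvg_cst.
  rewrite -[X in _ --> X](mulr0 (l1norm (dag V))); apply: cvgM; first exact: cvg_cst.
  rewrite -[X in _ --> X](@big1_eq R 0 +%R 'I_m (index_enum _) predT).
  apply: cvg_big => [|j _]; first exact: add_continuous.
  rewrite -[X in _ --> X](addr0 0); apply: cvgD.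
    rewrite -[X in _ --> X](normr0 R) -[X in `|X|](subrr 0).
    apply: cvg_norm; apply: cvgB; last exact: cvg_cst.
    apply: (is_derive_quotient (f := fun t => cos (t * l j))).
    apply: is_derive_eq.
    by rewrite mul0r sin0 oppr0 mul0r.
  rewrite -[X in _ --> X](normr0 R) -[X in `|X|](subrr (l j)).
  apply: cvg_norm; apply: cvgB; last exact: cvg_cst.
  apply: (is_derive_quotient (f := fun t => sin (t * l j))).
  apply: is_derive_eq.
  by rewrite mul0r cos0 mul1r scaler0 add0r [_%:A]mulr1.
move=> t t0; rewrite Ut_spectral//.
set X := (X in l1norm X <= _).
pose c j : C := expi (t * l j) - 1 + Complex 0 (t * l j).
have -> : X = dag V *m diag_mx (\row_j c j) *m V.
  have -> : X = dag V *m (diag_mx (\row_j expi (t * l j)) - 1%:M +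
      Complex 0 t *: diag_mx (\row_j (l j)%:C)) *m V.
    by rewrite mulmxDr mulmxBr mulmx1 mulmxDl mulmxBl V2 -scalemxAr -scalemxAl.
  congr (_ *m _ *m _); apply/matrixP => i j; rewrite !mxE.
  have [->|_] := eqVneq i j; last by rewrite !mulr0n mulr0 subr0 addr0.
  rewrite !mulr1n; congr (_ + _).
  by apply/eqP; rewrite eq_complex /=; apply/andP; split; apply/eqP; ring.
rewrite (le_trans (l1normM _ _))// mulrA ler_wpM2r ?l1norm_ge0//.
rewrite (le_trans (l1normM _ _))// mulrCA ler_wpM2l ?l1norm_ge0// l1norm_diag.
rewrite mulr_sumr; apply: ler_sum => j _.
have -> : c j = Complex (cos (t * l j) - 1) (- (sin (t * l j) - t * l j)).
  by apply/eqP; rewrite eq_complex /=; apply/andP; split; apply/eqP; ring.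
rewrite (le_trans (normc_le _ _))// normrN mulrDr /f /g -!normrM.
rewrite !mul0r cos0 sin0 !subr0 mulrCA divff// mulr1 mulrBr mulrCA divff// mulr1.
by [].
Qed.

(* minus the time derivative at [0] of [U_t rho U_t^dag] *)
Definition velocity m (H rho : 'M[C]_m) := Complex 0 1 *: (H *m rho - rho *m H).

(** With $U = 1 + W$ and $W = E - itH$, the terms linear in [t] form the velocity, and $E\rho + \rho
    E^\dagger + W\rho W^\dagger$ remains. *)
Lemma quotient_cvg m (H rho : 'M[C]_m) : is_herm H ->
  exists2 e : R -> R, e t @[t --> 0^'] --> 0 &
    forall t, t != 0 -> l1norm ((t%:C)^-1 *: (rho - Ut H t *m rho *m dag (Ut H t))
      - velocity H rho) <= e t.
Proof.
move=> hH; have [e e0 he] := Ut_first_order hH.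
pose r := l1norm rho; pose h := l1norm H.
(* The first summand bounds the two terms with [E], the second the quadratic term in [W], where
   [l1norm W] is at most [|t| * (h + e t)]. *)
exists (fun t => 2 * e t * r + `|t| * (h + e t) ^+ 2 * r).
  have t0 : `|t| @[t --> (0:R)^'] --> (0 : R).
    rewrite -[X in _ --> X](normr0 R); apply: cvg_norm.
    by apply: (cvg_trans _ (@cvg_id _ _)); exact: cvg_within.
  rewrite -[X in _ --> X](addr0 0); apply: cvgD.
    rewrite -[X in _ --> X](mul0r r); apply: cvgM; last exact: cvg_cst.
    by rewrite -[X in _ --> X](mulr0 2); apply: cvgM => //; exact: cvg_cst.
  rewrite -[X in _ --> X](mul0r r); apply: cvgM; last exact: cvg_cst.
  rewrite -[X in _ --> X](mul0r ((h + 0) ^+ 2)); apply: cvgM => //.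
  under eq_fun do rewrite expr2.
  by rewrite expr2; apply: cvgM; apply: cvgD => //; exact: cvg_cst.
move=> t t0; set U := Ut H t; set E := U - 1%:M + Complex 0 t *: H.
have lE : l1norm E <= `|t| * e t by exact: he.
have [W W0] : exists W, W = U - 1%:M by exists (U - 1%:M).
have eW : W = E - Complex 0 t *: H by rewrite W0 /E addrK.
have lW : l1norm W <= `|t| * (h + e t).
  rewrite eW (le_trans (l1normD _ _))// l1normN l1normZ normc_imag mulrDr addrC.
  by rewrite lerD2l.
have tc0 : t%:C != 0 by rewrite -[0]/((0 : R)%:C) (inj_eq (@complexI R)).
have -> : (t%:C)^-1 *: (rho - U *m rho *m dag U) - velocity H rho =
    - (t%:C)^-1 *: (E *m rho + rho *m dag E + W *m rho *m dag W).
  have eU : U = 1%:M + W by rewrite W0 addrC subrK.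
  have dU : dag U = 1%:M + dag E + Complex 0 t *: H.
    rewrite eU eW dagD dagB dagZ hH.
    rewrite dag1 addrA; congr (_ + _); rewrite -scaleNr; congr (_ *: _).
    by apply/eqP; rewrite eq_complex /= oppr0 opprK !eqxx.
  have dW : dag W = dag E + Complex 0 t *: H.
    rewrite W0 dagB dU.
    by rewrite dag1 addrC !addrA addNr add0r.
  have -> : velocity H rho =
      (t%:C)^-1 *: (Complex 0 t *: (H *m rho - rho *m H)).
    rewrite /velocity scalerA; congr (_ *: _); apply: (mulfI tc0); rewrite mulVKf//.
    by apply/eqP; rewrite eq_complex /=; apply/andP; split; apply/eqP; ring.
  rewrite -scalerBr scaleNr -scalerN; congr (_ *: _).
  have eU1 : U *m rho = rho + W *m rho by rewrite eU mulmxDl mul1mx.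
  have dU1 : dag U = 1%:M + dag W by rewrite dU dW addrA.
  have eW1 : W *m rho = E *m rho - Complex 0 t *: (H *m rho).
    by rewrite eW mulmxBl -scalemxAl.
  have dW1 : rho *m dag W = rho *m dag E + Complex 0 t *: (rho *m H).
    by rewrite dW mulmxDr -scalemxAr.
  rewrite eU1 dU1 mulmxDr mulmx1 mulmxDl dW1.
  move: (W *m rho *m dag W) => M1; rewrite eW1.
  move: (E *m rho) (rho *m dag E) (H *m rho) (rho *m H) => M2 M3 M4 M5.
  by apply/matrixP => i j; rewrite !mxE; ring.
rewrite l1normZ normcN Normc.normcV normc_real.
rewrite ler_pdivrMl ?normr_gt0//.
have -> : `|t| * (2 * e t * r + `|t| * (h + e t) ^+ 2 * r) =
   `|t| * e t * r + r * (`|t| * e t) + (`|t| * (h + e t)) * r * (`|t| * (h + e t)) by ring.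
rewrite (le_trans (l1normD _ _))// lerD//.
  rewrite (le_trans (l1normD _ _))// lerD// (le_trans (l1normM _ _))//.
    by rewrite ler_wpM2r ?l1norm_ge0.
  by rewrite ler_wpM2l ?l1norm_ge0// l1norm_dag.
rewrite (le_trans (l1normM _ _))// l1norm_dag ler_pM ?l1norm_ge0//.
by rewrite (le_trans (l1normM _ _))// ler_wpM2r ?l1norm_ge0.
Qed.

(* [P], [Q] are the rank-one matrices of [a psi + i b phi] and [a psi - i b phi], with
   [a b = 1/2] and [a], [b] balanced so that [a |psi| = b |phi|]. *)
Lemma velocity_psd m (H : 'M[C]_m) (psi : 'cV[C]_m) : is_herm H -> vnorm psi = 1 ->
  exists P Q : 'M[C]_m, [/\ psd P, psd Q, velocity H (psi *m dag psi) = P - Q &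
    complex.Re (\tr P) + complex.Re (\tr Q) = 2 * vnorm (H *m psi)].
Proof.
move=> hH psi1; set phi := H *m psi.
have eA : velocity H (psi *m dag psi) =
    Complex 0 1 *: (phi *m dag psi - psi *m dag phi).
  by rewrite /velocity /phi dagM hH !mulmxA.
(* The balancing below divides by the norm of [phi]. *)
have [c0|c0] := eqVneq (vnorm phi) 0.
  exists 0, 0; split; [exact: psd0|exact: psd0| |].
    by rewrite eA (vnorm_eq0 c0) dag0 mulmx0 mul0mx subrr scaler0.
  by rewrite mxtrace0 addr0 c0 mulr0.
have {}c0 : 0 < vnorm phi by rewrite lt_neqAle eq_sym c0 vnorm_ge0.
set c := vnorm phi in c0 *.
pose a := Num.sqrt (c / 2); pose b := a / c.
have aa : a * a = c / 2 by rewrite -expr2 sqr_sqrtr// divr_ge0// ltW.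
have ab : a * b = 2^-1.
  by rewrite /b mulrA aa; field; rewrite gt_eqF.
have bb : b * b = (2 * c)^-1.
  by rewrite /b mulrACA aa; field; rewrite gt_eqF.
have dE s : dag (a%:C *: psi + Complex 0 (s * b) *: phi) =
    a%:C *: dag psi + Complex 0 (- (s * b)) *: dag phi.
  by rewrite dagD !dagZ conj_realc.
(* Both signs are treated at once with [s] equal to 1 or -1. The cross term is odd in [s]: it
   survives in [P - Q] and cancels in the sum of the traces. *)
have vE s : (a%:C *: psi + Complex 0 (s * b) *: phi) *m
    dag (a%:C *: psi + Complex 0 (s * b) *: phi) =
    (c / 2)%:C *: (psi *m dag psi) + (s ^+ 2 * (2 * c)^-1)%:C *: (phi *m dag phi) +
    (Complex 0 (s / 2)) *: (phi *m dag psi - psi *m dag phi).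
  rewrite dE mulmxDl !mulmxDr -!scalemxAl -!scalemxAr !scalerA.
  have -> : a%:C * a%:C = (c / 2)%:C by rewrite -rmorphM aa.
  have -> : a%:C * Complex 0 (- (s * b)) = Complex 0 (- (s / 2)).
    by apply/eqP; rewrite eq_complex /=; apply/andP; split; apply/eqP; rewrite -?ab; ring.
  have -> : Complex 0 (s * b) * a%:C = Complex 0 (s / 2).
    by apply/eqP; rewrite eq_complex /=; apply/andP; split; apply/eqP; rewrite -?ab; ring.
  have -> : Complex 0 (s * b) * Complex 0 (- (s * b)) = (s ^+ 2 * (2 * c)^-1)%:C.
    by apply/eqP; rewrite eq_complex /=; apply/andP; split; apply/eqP; rewrite -?bb; ring.
  have -> : Complex 0 (- (s / 2)) = - Complex 0 (s / 2) :> C.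
    by apply/eqP; rewrite eq_complex /= oppr0 !eqxx.
  move: (psi *m dag psi) (phi *m dag phi) (phi *m dag psi) (psi *m dag phi).
  by move=> M1 M2 M3 M4; apply/matrixP => i j; rewrite !mxE; ring.
exists ((a%:C *: psi + Complex 0 (1 * b) *: phi) *m
    dag (a%:C *: psi + Complex 0 (1 * b) *: phi)),
  ((a%:C *: psi + Complex 0 (-1 * b) *: phi) *m
    dag (a%:C *: psi + Complex 0 (-1 * b) *: phi)).
split; [exact: psd_rank1|exact: psd_rank1| |].
  rewrite !vE sqrrN eA opprD addrACA subrr add0r -scalerBl; congr (_ *: _).
  by apply/eqP; rewrite eq_complex /=; apply/andP; split; apply/eqP; field.
rewrite -raddfD /= -mxtraceD !vE sqrrN expr1n mul1r.
set Z := phi *m dag psi - psi *m dag phi.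
have -> : Complex 0 (-1 / 2) *: Z = - (Complex 0 (1 / 2) *: Z).
  by rewrite -scaleNr; congr (_ *: _); apply/eqP; rewrite eq_complex /= oppr0 mulN1r mul1r !eqxx.
rewrite addrACA subrr addr0 mxtraceD !mxtraceD !mxtraceZ !tr_rank1 psi1 -/c.
rewrite -!rmorphM -!rmorphD /=; field.
by rewrite gt_eqF.
Qed.

End Rate.

Theorem theorem1 (R : realType) (n d k : nat) (hd : (2 <= d)%N)
  (H : 'M[R[i]]_(qdim n d)) (psi : 'cV[R[i]]_(qdim n d))
  (hH : is_herm H)
  (hloc : exists (S : {set 'I_n}) (h : 'M[R[i]]_(qdim #|S| d)),
            #|S| = k /\ H = embed (S := S) h)
  (hpsi : vnorm psi = 1) :
  cvg (W1quot psi H t @[t --> 0^']) /\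
  lim (W1quot psi H t @[t --> 0^']) <= 2 * Num.sqrt 2 * k%:R * opnorm H.
Proof.
have [S [h [Sk eH]]] := hloc.
pose o : 'I_d := Ordinal (ltnW hd).
set rho := psi *m dag psi.
have hrho : is_herm rho by rewrite /is_herm dagM dagK.
have [P [Q [pP pQ ePQ trPQ]]] := velocity_psd hH hpsi.
have tV : tlherm (velocity H rho).
  split; first by rewrite ePQ /is_herm dagB pP.1 pQ.1.
  by rewrite /velocity linearZ linearB /= mxtrace_mulC subrr mulr0.
have tQ t : tlherm ((t%:C)^-1 *: (rho - Ut H t *m rho *m dag (Ut H t))).
  split.
    by rewrite /is_herm dagZ dagB hrho (herm_congr _ hrho) -fmorphV conj_realc.
  rewrite linearZ linearB /= [X in _ - X]mxtrace_mulC mulmxA Ut_unitary// mul1mx.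
  by rewrite subrr mulr0.
have lim1 : W1quot psi H t @[t --> 0^'] --> W1norm (velocity H rho).
  have [e e0 he] := quotient_cvg rho hH.
  (* By the Lipschitz bound the quotient lies between [g (-1)] and [g 1], which share a limit. *)
  pose g (s : R) t := W1norm (velocity H rho) + s * (n%:R * e t).
  have gc s : g s t @[t --> 0^'] --> W1norm (velocity H rho).
    rewrite -[X in _ --> X](addr0 (W1norm (velocity H rho))).
    apply: cvgD; first exact: cvg_cst.
    rewrite -[X in _ --> X](mulr0 s); apply: cvgM; first exact: cvg_cst.
    by rewrite -[X in _ --> X](mulr0 n%:R); apply: cvgM => //; exact: cvg_cst.
  apply: (@squeeze_cvgr _ _ _ _ (g (-1)) (g 1)) => //.
  near=> t.
  have t0 : t != 0 by near: t; exact: nbhs_dnbhs_neq.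
  have := W1norm_lipschitz o (tQ t) tV.
  have ln : n%:R * l1norm ((t%:C)^-1 *: (rho - Ut H t *m rho *m dag (Ut H t))
      - velocity H rho) <= n%:R * e t by rewrite ler_wpM2l// he.
  move=> /le_trans/(_ ln); rewrite -/rho /W1quot /g ler_distl mulN1r mul1r.
  by [].
split; first by apply/cvg_ex; eexists; exact: lim1.
rewrite (cvg_lim _ lim1)//.
have S0 : reset o S (P - Q) = 0.
  rewrite -ePQ /velocity.
  have resetZ (a : R[i]) X : reset o S (a *: X) = a *: reset o S X.
    by rewrite scaler_sumr; apply: eq_bigr => z _; rewrite -scalemxAr -scalemxAl.
  by rewrite resetZ eH reset_commutator ?scaler0// -eH.
(* The bound obtained is $2k\|H\psi\|$; then $\|H\psi\|\le\|H\|_\infty$ and $1\le\sqrt2$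
   conclude. *)
rewrite ePQ (le_trans (W1norm_le pP pQ S0))// trPQ Sk.
rewrite mulrCA -!mulrA ler_wpM2l//.
have oH : 0 <= opnorm H by rewrite (le_trans _ (vnorm_le_opnorm _ hpsi))// vnorm_ge0.
rewrite mulrCA ler_wpM2l//.
rewrite (le_trans (vnorm_le_opnorm _ hpsi))// ler_peMl//.
by rewrite -[leLHS]sqrtr1 ler_sqrt// ler1n.
Unshelve. all: by end_near.
Qed.
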